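(* There are infinitely many affine algebraic curves $C\subset\mathbb{C}^2$ that are invariant under the Chebyshev-induced morphisms $g_d$ on $\mathbb{C}^2/D_3\simeq\mathbb{C}^2$, i.e. such that $g_d(C)=C$ for every $d\in\mathbb{N}$.
   Context: $\mathbb{N}=\{1,2,\dots\}$. An affine algebraic curve is an irreducible algebraic set of dimension 1. Definition of $g_d$: the Chebyshev endomorphism $P_{A_2}^d:\mathbb{C}^2\to\mathbb{C}^2$ is defined by $P_{A_2}^d(e_1(t),e_2(t))=(e_1(t^d),e_2(t^d))$ for $t=(t_1,t_2,t_3)\in(\mathbb{C}^* )^3$ with $t_1t_2t_3=1$, where $t^d=(t_1^d,t_2^d,t_3^d)$ and $e_j$ is the $j$-th elementary symmetric polynomial. With $M_2(x,y)=(x+iy,\,x-iy)$ put $f_d=M_2^{-1}\circ P_{A_2}^d\circ M_2$. The surjective map $\tilde F:\mathbb{C}^2\to\mathbb{C}^2$, $\tilde F(x,y)=(x^2+y^2,\,x^3-3xy^2)$, is the quotient map by the dihedral group $D_3\subset GL(2,\mathbb{R})$ of order 6 generated by the rotation by $2\pi/3$ and $(x,y)\mapsto(x,-y)$; $g_d:\mathbb{C}^2\to\mathbb{C}^2$ is the unique polynomial map with $g_d\circ\tilde F=\tilde F\circ f_d$. *)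

(* Defs.v *)
(* The complex numbers are R[i] for R : realType. *)
From HB Require Import structures.
From mathcomp Require Import all_boot all_order all_algebra.
From mathcomp Require Import boolp classical_sets cardinality reals.
From mathcomp Require Import complex mpoly.
From mathcomp Require Import ring.

Set Implicit Arguments.
Unset Strict Implicit.
Unset Printing Implicit Defensive.

Import GRing.Theory.
Local Open Scope ring_scope.
Local Open Scope classical_set_scope.

Section AffinePlane.
Variable R : realType.
Local Notation C := R[i].

Definition plane : Type := (C * C)%type.

Definition coords (z : plane) : 'I_2 -> C := tnth [tuple z.1; z.2].

Definition zero_locus (S : set {mpoly C[2]}) : set plane :=
  [set z | forall p, S p -> p.@[coords z] = 0].

Definition algebraic (A : set plane) : Prop :=
  exists S : set {mpoly C[2]}, A = zero_locus S.

Definition irreducible (A : set plane) : Prop :=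
  [/\ algebraic A, A !=set0 &
      forall A1 A2 : set plane, algebraic A1 -> algebraic A2 ->
        A = A1 `|` A2 -> A = A1 \/ A = A2].

(* A strict chain Z 0 < ... < Z n of irreducible algebraic subsets of A;
   such a chain has length n, and Z k is irrelevant for k > n. *)
Definition irreducible_chain (A : set plane) (n : nat) (Z : nat -> set plane) :
    Prop :=
  (forall k, (k <= n)%N -> irreducible (Z k) /\ Z k `<=` A) /\
  (forall k, (k < n)%N -> Z k `<` Z k.+1).

(* Krull dimension: n is the supremum of the lengths of such chains. *)
Definition has_dim (A : set plane) (n : nat) : Prop :=
  (exists Z, irreducible_chain A n Z) /\
  (forall m Z, irreducible_chain A m Z -> (m <= n)%N).

Definition affine_curve (A : set plane) : Prop :=
  irreducible A /\ has_dim A 1.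

Definition polymap : Type := ({mpoly C[2]} * {mpoly C[2]})%type.

Definition pmap_eval (G : polymap) (z : plane) : plane :=
  (G.1.@[coords z], G.2.@[coords z]).

Definition torus : set ('I_3 -> C) :=
  [set t | (forall i, t i != 0) /\ \prod_(i < 3) t i = 1].

Definition e12 (t : 'I_3 -> C) : plane :=
  ((mesym 3 C 1).@[t], (mesym 3 C 2).@[t]).

Definition is_cheb (d : nat) (P : polymap) : Prop :=
  forall t, torus t -> pmap_eval P (e12 t) = e12 (fun i => t i ^+ d).

(* [xget 0] picks the unique map with the given property; the default value,
   the zero map, would be returned only if there were none. *)
Definition cheb (d : nat) : polymap := xget 0 (is_cheb d).

Definition M2 (z : plane) : plane :=
  (z.1 + 'i%C * z.2, z.1 - 'i%C * z.2).

Definition M2_inv (w : plane) : plane :=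
  ((w.1 + w.2) / 2, (w.1 - w.2) / (2 * 'i%C)).

Lemma im_neq0 : 'i%C != 0 :> C.
Proof. by rewrite eq_complex /= oner_eq0 andbF. Qed.

Lemma M2K : cancel M2 M2_inv.
Proof.
have i0 := im_neq0; have n2 : 2 != 0 :> C by rewrite Num.Theory.pnatr_eq0.
by case=> x y; congr pair => /=; field; rewrite ?i0 ?n2.
Qed.

Lemma M2_invK : cancel M2_inv M2.
Proof.
have i0 := im_neq0; have n2 : 2 != 0 :> C by rewrite Num.Theory.pnatr_eq0.
by case=> x y; congr pair => /=; field; rewrite ?i0 ?n2.
Qed.

Definition f_cheb (d : nat) : plane -> plane :=
  M2_inv \o pmap_eval (cheb d) \o M2.

Definition F_tilde (z : plane) : plane :=
  (z.1 ^+ 2 + z.2 ^+ 2, z.1 ^+ 3 - 3 * z.1 * z.2 ^+ 2).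

Definition is_induced (d : nat) (G : polymap) : Prop :=
  pmap_eval G \o F_tilde = F_tilde \o f_cheb d.

Definition g_cheb (d : nat) : polymap := xget 0 (is_induced d).

End AffinePlane.

(* Main.v *)
(* In the coordinates u = x + iy, v = x - iy the quotient map by D_3 is
   (uv, (u^3 + v^3)/2), and f_d sends (e_1(t), e_2(t)) to (e_1(t^d), e_2(t^d)).
   The one-parameter subtori t = (s, s^(n+2), s^-(n+3)) are mapped onto
   themselves by t |-> t^d, so their images in C^2/D_3 are invariant. Inverting
   s swaps u and v, so these images are parametrized by polynomials in s + 1/s:
   they are images of nonconstant polynomial maps C -> C^2, which are closed (by
   resultants) and irreducible of dimension 1.
   If only finitely many curves arose, one curve A would contain the images of
   infinitely many of the subtori. A polynomial vanishing on A, pulled back to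
   the torus as a Laurent polynomial in (s, t), then vanishes for s = 2, 3, ...
   at infinitely many powers t = s^m, hence identically. So A would contain
   every point (0, y); but A meets that line in finitely many points. *)
Require Import Defs.
From mathcomp Require Import all_boot all_order all_algebra.
From mathcomp Require Import boolp classical_sets cardinality reals.
From mathcomp Require Import complex mpoly.
From mathcomp Require Import ring zify.

Set Implicit Arguments.
Unset Strict Implicit.
Unset Printing Implicit Defensive.

Import GRing.Theory.
Local Open Scope ring_scope.
Local Open Scope classical_set_scope.

(** * Torus points and their elementary symmetric functions *)

Section ChebyshevQuotient.
Variable R : realType.
Local Notation C := R[i].
Local Notation pt := (@coords R).

Lemma meval0U (z : plane R) : ('X_ord0 : {mpoly C[2]}).@[pt z] = z.1.
Proof. by rewrite mevalXU. Qed.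

Lemma meval1U (z : plane R) : ('X_ord_max : {mpoly C[2]}).@[pt z] = z.2.
Proof. by rewrite mevalXU. Qed.

Definition tri (x y z : C) : 'I_3 -> C := tnth [tuple x; y; z].

Lemma e12E (t : 'I_3 -> C) (x y z : C) :
    t ord0 = x -> t 1 = y -> t ord_max = z ->
  e12 t = (x + y + z, x * y + x * z + y * z).
Proof.
move=> tx ty tz.
have e (i : 'I_2) : mwiden ('X_i : {mpoly C[2]}) = 'X_(widen_ord (leqnSn 2) i).
  by rewrite mwidenX mnmwiden1.
rewrite /e12 mesym1E mesymSS (mesymnnE 2) mesym1E.
rewrite !big_ord_recr !big_ord0 /= !add0r !mul1r.
rewrite !(mwidenD, rmorphM) /= !e !(mevalD, mevalM, mevalXU).
have -> : widen_ord (leqnSn 2) (widen_ord (leqnSn 1) ord_max) = ord0 :> 'I_3.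
  exact/val_eqP.
have -> : widen_ord (leqnSn 2) ord_max = 1 :> 'I_3 by apply/val_eqP.
by rewrite tx ty tz; congr pair; ring.
Qed.

Lemma e12_tri x y z : e12 (tri x y z) = (x + y + z, x * y + x * z + y * z).
Proof. exact: e12E. Qed.

Lemma torus_tri x y z : x * y * z = 1 -> torus (tri x y z).
Proof.
move=> xyz; split; last by rewrite !big_ord_recr big_ord0 /= mul1r.
suff [x0 y0 z0] : [/\ x != 0, y != 0 & z != 0] by case=> [[|[|[|]]]].
have /eqP := xyz; split; apply: contra_eqN xyz => /eqP ->;
  by rewrite ?(mulr0, mul0r) eq_sym oner_neq0.
Qed.

Lemma torusE (t : 'I_3 -> C) : torus t ->
  exists x y z, [/\ x * y * z = 1, t ord0 = x, t 1 = y & t ord_max = z].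
Proof.
case=> _ t1; exists (t ord0), (t 1), (t ord_max); split=> //.
rewrite -t1 !big_ord_recr big_ord0 /= mul1r.
by congr (t _ * t _ * t _); apply/val_eqP.
Qed.

Lemma cubic_root (a b c : C) : exists x, x ^+ 3 = a + b * x + c * x ^+ 2.
Proof.
have [x xE] := @GRing.solve_monicpoly C 3 (fun i => [:: a; b; c]`_i) isT.
by exists x; rewrite xE !big_ord_recr big_ord0 /= add0r mulr1.
Qed.

Lemma quadratic_root (a b : C) : exists x, x ^+ 2 = a + b * x.
Proof.
have [x xE] := @GRing.solve_monicpoly C 2 (fun i => [:: a; b]`_i) isT.
by exists x; rewrite xE !big_ord_recr big_ord0 /= add0r mulr1.
Qed.

(** The entries of [t] are the roots of X^3 - a X^2 + b X - 1: one root [x], then the roots [y] and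
    [a - x - y] of the quadratic cofactor. *)
Lemma e12_surj (w : plane R) : exists2 t, torus t & e12 t = w.
Proof.
case: w => a b; have [x x3] := cubic_root 1 (- b) a.
have x0 : x != 0.
  apply: contra_eqN x3 => /eqP ->.
  by rewrite expr0n !mulr0 expr0n /= mulr0 !addr0 eq_sym oner_neq0.
have [y y2] := quadratic_root (- x^-1) (a - x).
have xyz : y * (a - x - y) = x^-1.
  by rewrite mulrBr -expr2 y2; ring.
exists (tri x y (a - x - y)).
  by apply: torus_tri; rewrite -mulrA xyz mulfV.
rewrite e12_tri xyz; congr pair; first by ring.
apply: (mulfI x0); rewrite !mulrDr mulfV //.
have -> : x * b = 1 + a * x ^+ 2 - x ^+ 3 by rewrite x3; ring.
by ring.
Qed.

(** * Power sums and the Chebyshev endomorphism *)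

(* Three consecutive power sums, starting in degree d, of three numbers of
   product 1 whose first two elementary symmetric functions are u and v. *)
Fixpoint cheb3 (A : comPzRingType) (u v : A) (d : nat) : A * A * A :=
  if d is d'.+1 then
    let: (a, b, c) := cheb3 u v d' in (b, c, u * c - v * b + a)
  else (3, u, u ^+ 2 - 2 * v).

Definition psum (A : comPzRingType) (u v : A) d := (cheb3 u v d).1.1.

Lemma psumSSS (A : comPzRingType) (u v : A) d :
  psum u v d.+3 = u * psum u v d.+2 - v * psum u v d.+1 + psum u v d.
Proof. by rewrite /psum /=; case: (cheb3 u v d) => [[]]. Qed.

Lemma rmorph_psum (A B : comPzRingType) (f : {rmorphism A -> B}) u v d :
  f (psum u v d) = psum (f u) (f v) d.
Proof.
suff [] : [/\ f (psum u v d) = psum (f u) (f v) d,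
    f (psum u v d.+1) = psum (f u) (f v) d.+1 &
    f (psum u v d.+2) = psum (f u) (f v) d.+2] by [].
elim: d => [|d [e0 e1 e2]]; last first.
  by split=> //; rewrite !psumSSS rmorphD rmorphB !rmorphM e0 e1 e2.
by split; rewrite /psum /= ?rmorphB ?rmorphXn ?rmorphM ?rmorph_nat.
Qed.

Lemma psumE (A : comPzRingType) (x y z : A) d : x * y * z = 1 ->
  psum (x + y + z) (x * y + x * z + y * z) d = x ^+ d + y ^+ d + z ^+ d.
Proof.
move=> xyz; set u := x + _ + _; set v := _ * _ + _ + _.
suff [] : [/\ psum u v d = x ^+ d + y ^+ d + z ^+ d,
    psum u v d.+1 = x ^+ d.+1 + y ^+ d.+1 + z ^+ d.+1 &
    psum u v d.+2 = x ^+ d.+2 + y ^+ d.+2 + z ^+ d.+2] by [].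
elim: d => [|d [e0 e1 e2]]; last first.
  (* Multiplying the lowest term by xyz = 1 turns the recurrence into a polynomial identity. *)
  split=> //; rewrite psumSSS e0 e1 e2 -[_ + _ + z ^+ d]mul1r -xyz !exprS /u /v.
  by ring.
by split; rewrite /psum /= /u /v; ring.
Qed.

Lemma psum_e12 (t : 'I_3 -> C) d : torus t ->
  e12 (fun i => t i ^+ d) =
    (psum (e12 t).1 (e12 t).2 d, psum (e12 t).2 (e12 t).1 d).
Proof.
move=> /torusE[x [y [z [xyz tx ty tz]]]].
rewrite (e12E tx ty tz) (@e12E _ (x ^+ d) (y ^+ d) (z ^+ d)) ?tx ?ty ?tz //=.
rewrite psumE //; congr pair.
(* The second component sums the d-th powers of xy, xz, yz; these have product 1, sum e_2 and second
   symmetric function e_1. *)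
have -> : x + y + z = (x * y) * (x * z) + (x * y) * (y * z) + (x * z) * (y * z).
  by rewrite -[LHS]mul1r -xyz; ring.
rewrite psumE ?exprMn //.
have -> : x * y * (x * z) * (y * z) = (x * y * z) ^+ 2 by ring.
by rewrite xyz expr1n.
Qed.

(** A witness makes the choice by [xget] meaningful: [psum] at the two variables, in both orders. *)
Lemma chebP d : is_cheb d (cheb R d).
Proof.
apply: xgetPex; exists (psum 'X_ord0 'X_ord_max d, psum 'X_ord_max 'X_ord0 d).
move=> t tt; rewrite psum_e12 // /pmap_eval /=.
by rewrite !(rmorph_psum (meval _)) /= meval0U meval1U.
Qed.

(** Since [e12] maps the torus onto the plane, the values on torus points determine the map
    everywhere. *)
Lemma cheb_eval d (w : plane R) :
  pmap_eval (cheb R d) w = (psum w.1 w.2 d, psum w.2 w.1 d).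
Proof. by have [t tt <-] := e12_surj w; rewrite chebP // psum_e12. Qed.

(** * Dihedral invariants and the induced map *)

Definition inv12 (w : plane R) : plane R :=
  (w.1 * w.2, (w.1 ^+ 3 + w.2 ^+ 3) / 2).

Lemma two_neq0 : 2 != 0 :> C.
Proof. by rewrite Num.Theory.pnatr_eq0. Qed.

Lemma F_tildeE z : F_tilde z = inv12 (M2 z).
Proof.
have i2 : 'i%C ^+ 2 = -1 :> C by rewrite sqr_i.
case: z => x y; rewrite /F_tilde /inv12 /=; congr pair.
  have -> : (x + 'i%C * y) * (x - 'i%C * y) = x ^+ 2 - 'i%C ^+ 2 * y ^+ 2.
    by ring.
  by rewrite i2; ring.
have -> : (x + 'i%C * y) ^+ 3 + (x - 'i%C * y) ^+ 3 =
    (x ^+ 3 + 3 * x * ('i%C ^+ 2 * y ^+ 2)) * 2 by ring.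
by rewrite i2 mulfK ?two_neq0 //; ring.
Qed.

(** [S] omits the factor 1/2, so that later identities in [N] and [S] have integer coefficients. *)
Lemma inv12_gens : exists N S : {mpoly C[2]},
  (forall w, N.@[pt (inv12 w)] = w.1 * w.2) /\
  (forall w, S.@[pt (inv12 w)] = w.1 ^+ 3 + w.2 ^+ 3).
Proof.
exists 'X_ord0, (2 *: 'X_ord_max); split=> w; first by rewrite meval0U.
by rewrite mevalZ meval1U /= mulrC divfK ?two_neq0.
Qed.

(* Under the rotation (u, v) |-> (w u, w^2 v), with w^3 = 1, psum u v d is
   multiplied by w^d; so it lies in the corresponding isotypic component, which
   is free of rank 2 over the ring of invariants. *)
Lemma psum_isotypic k : exists a b : 'I_3 -> {mpoly C[2]}, forall w : plane R,
  let ev (p : {mpoly C[2]}) := p.@[pt (inv12 w)] in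
  [/\ psum w.1 w.2 (3 * k) = ev (a 0) + ev (b 0) * w.1 ^+ 3,
      psum w.1 w.2 (3 * k).+1 = ev (a 1) * w.1 + ev (b 1) * w.2 ^+ 2 &
      psum w.1 w.2 (3 * k).+2 = ev (a 2%:R) * w.2 + ev (b 2%:R) * w.1 ^+ 2].
Proof.
suff [[a0 b0] [[a1 b1] [[a2 b2] h]]] :
    exists ab0 ab1 ab2 : {mpoly C[2]} * {mpoly C[2]},
    forall w : plane R, let ev (p : {mpoly C[2]}) := p.@[pt (inv12 w)] in
    [/\ psum w.1 w.2 (3 * k) = ev ab0.1 + ev ab0.2 * w.1 ^+ 3,
      psum w.1 w.2 (3 * k).+1 = ev ab1.1 * w.1 + ev ab1.2 * w.2 ^+ 2 &
      psum w.1 w.2 (3 * k).+2 = ev ab2.1 * w.2 + ev ab2.2 * w.1 ^+ 2].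
  by exists (tnth [tuple a0; a1; a2]), (tnth [tuple b0; b1; b2]) => w; exact: h.
have [N [S [evN evS]]] := inv12_gens.
elim: k => [|k [[a0 b0] [[a1 b1] [[a2 b2] h]]]].
  exists (3%:MP, 0), (1, 0), ((-2)%:MP, 1) => w /=.
  by rewrite /psum /= !(mevalC, meval0, meval1); split; ring.
(* p0' = u p2 - v p1 + p0, p1' = u p0' - v p2 + p1, p2' = u p1' - v p0' + p2 *)
pose a0' := a2 * N - a1 * N - b1 * S + a0; pose b0' := b2 + b1 + b0.
pose a1' := a0' + b0' * S - b2 * N + a1; pose b1' := - b0' * N - a2 + b1.
pose a2' := b1' * N - a0' + a2; pose b2' := a1' - b0' * N + b2.
exists (a0', b0'), (a1', b1'), (a2', b2') => w /=.
have [e0 e1 e2] := h w.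
(* The three checks reduce monomials by uv = N, v^3 = S - u^3 and u^4 = S u - N v^2. *)
have e0' : psum w.1 w.2 (3 * k.+1) =
    a0'.@[pt (inv12 w)] + b0'.@[pt (inv12 w)] * w.1 ^+ 3.
  rewrite mulnS psumSSS e0 e1 e2 /a0' /b0' !(mevalD, mevalN, mevalM) evN evS /=.
  by ring.
have e1' : psum w.1 w.2 (3 * k.+1).+1 =
    a1'.@[pt (inv12 w)] * w.1 + b1'.@[pt (inv12 w)] * w.2 ^+ 2.
  rewrite mulnS psumSSS -[(3 * k).+3]/(3 + 3 * k)%N -mulnS e0' e1 e2 /a1' /b1'.
  by rewrite !(mevalD, mevalN, mevalM) evN evS /=; ring.
split=> //; rewrite [in LHS]mulnS psumSSS.
rewrite -[(3 * k).+4]/(3 + 3 * k).+1%N -[(3 * k).+3]/(3 + 3 * k)%N -mulnS.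
rewrite e0' e1' e2 /a2' /b2' !(mevalD, mevalN, mevalM) evN /=.
by ring.
Qed.

(** The product and the sum of cubes of [psum u v d] and [psum v u d] are invariant under D_3; they
    are expanded in [N] and [S] for each residue of [d] modulo 3. *)
Lemma inducedP d : is_induced d (g_cheb R d).
Proof.
apply: xgetPex.
suff [G1 [G2 HG]] : exists G1 G2 : {mpoly C[2]}, forall w : plane R,
    (G1.@[pt (inv12 w)], G2.@[pt (inv12 w)]) =
      inv12 (psum w.1 w.2 d, psum w.2 w.1 d).
  exists (G1, G2); apply/funext => z /=.
  by rewrite !F_tildeE M2_invK cheb_eval -HG.
have [N [S [evN evS]]] := inv12_gens.
(* Swapping u and v fixes the invariants, so the same coefficients [a], [b] describe both power
   sums. *)
have inv12C (w : plane R) : inv12 (w.2, w.1) = inv12 w.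
  by rewrite /inv12 /= mulrC addrC.
have [a [b h]] := psum_isotypic (d %/ 3).
have -> : d = (3 * (d %/ 3) + d %% 3)%N by rewrite mulnC -divn_eq.
have : (d %% 3 < 3)%N by rewrite ltn_mod.
move: (d %% 3)%N => [|[|[|//]]] _; rewrite ?(addn0, addn1, addn2).
(* The expansion uses u^6 + v^6 = S^2 - 2 N^3 and u^9 + v^9 = S^3 - 3 N^3 S. *)
- exists (a 0 ^+ 2 + a 0 * b 0 * S + b 0 ^+ 2 * N ^+ 3).
  exists (2^-1 *: (2 * a 0 ^+ 3 + 3 * a 0 ^+ 2 * b 0 * S
    + 3 * a 0 * b 0 ^+ 2 * (S ^+ 2 - 2 * N ^+ 3)
    + b 0 ^+ 3 * (S ^+ 3 - 3 * N ^+ 3 * S))) => w.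
  have [-> _ _] := h w; have [/= -> _ _] := h (w.2, w.1); rewrite inv12C.
  rewrite !(mevalZ, mevalD, mevalN, mevalM, rmorphXn, rmorph_nat) /= evN evS.
  by rewrite [RHS]/inv12 /=; congr pair; [|rewrite mulrC; congr (_ / _)]; ring.
- exists (a 1 ^+ 2 * N + a 1 * b 1 * S + b 1 ^+ 2 * N ^+ 2).
  exists (2^-1 *: (a 1 ^+ 3 * S + 6 * a 1 ^+ 2 * b 1 * N ^+ 2
    + 3 * a 1 * b 1 ^+ 2 * N * S + b 1 ^+ 3 * (S ^+ 2 - 2 * N ^+ 3))) => w.
  have [_ -> _] := h w; have [/= _ -> _] := h (w.2, w.1); rewrite inv12C.
  rewrite !(mevalZ, mevalD, mevalN, mevalM, rmorphXn, rmorph_nat) /= evN evS.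
  by rewrite [RHS]/inv12 /=; congr pair; [|rewrite mulrC; congr (_ / _)]; ring.
- exists (a 2%:R ^+ 2 * N + a 2%:R * b 2%:R * S + b 2%:R ^+ 2 * N ^+ 2).
  exists (2^-1 *: (a 2%:R ^+ 3 * S + 6 * a 2%:R ^+ 2 * b 2%:R * N ^+ 2
    + 3 * a 2%:R * b 2%:R ^+ 2 * N * S
    + b 2%:R ^+ 3 * (S ^+ 2 - 2 * N ^+ 3))) => w.
  have [_ _ ->] := h w; have [/= _ _ ->] := h (w.2, w.1); rewrite inv12C.
  rewrite !(mevalZ, mevalD, mevalN, mevalM, rmorphXn, rmorph_nat) /= evN evS.
  by rewrite [RHS]/inv12 /=; congr pair; [|rewrite mulrC; congr (_ / _)]; ring.
Qed.

Lemma g_cheb_e12 d (t : 'I_3 -> C) : torus t ->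
  pmap_eval (g_cheb R d) (inv12 (e12 t)) = inv12 (e12 (fun i => t i ^+ d)).
Proof.
move=> tt; rewrite -[e12 t]M2_invK -F_tildeE.
have /(congr1 (@^~ (M2_inv (e12 t)))) /= -> := inducedP d.
by rewrite F_tildeE M2_invK M2_invK chebP.
Qed.

End ChebyshevQuotient.

(** * Polynomial functions and finite algebraic sets *)

Section PolynomialCurves.
Variable R : realType.
Local Notation C := R[i].
Local Notation pt := (@coords R).

(** Induction principle for pullbacks, applied below to polynomial and to Laurent polynomial
    parametrizations. *)
Lemma mpoly_closed T (K : set (T -> C)) (f g : T -> C) (r : {mpoly C[2]}) :
    (forall c, K (fun=> c)) ->
    (forall a b, K a -> K b -> K (fun x => a x + b x)) ->
    (forall a b, K a -> K b -> K (fun x => a x * b x)) ->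
  K f -> K g -> K (fun x => r.@[pt (f x, g x)]).
Proof.
move=> Kc KD KM Kf Kg; have KX a n : K a -> K (fun x => a x ^+ n).
  move=> Ka; elim: n => [|n IH]; first exact: Kc.
  rewrite (_ : (fun _ => _) = (fun x => a x * a x ^+ n)).
    exact: (KM _ _ Ka IH).
  by apply/funext => x; rewrite exprS.
elim/mpolyind: r => [|c m r _ _ IH]; first by under eq_fun do rewrite meval0.
under eq_fun do rewrite mevalD mevalZ mevalX !big_ord_recr big_ord0 /= mul1r.
by apply: (KD _ _ (KM _ _ (Kc c) (KM _ _ (KX _ _ Kf) (KX _ _ Kg))) IH).
Qed.

Lemma infinite_C : infinite_set [set: C].
Proof.
move=> fC; apply: infinite_nat.
rewrite (_ : setT = (fun n : nat => n%:R : C) @^-1` setT) //.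
apply: finite_preimage fC => m n _ _ /eqP.
by rewrite Num.Theory.eqr_nat => /eqP.
Qed.

Lemma finite_roots (h : {poly C}) : h != 0 -> finite_set [set z | h.[z] = 0].
Proof.
move=> h0; have [r hE] := closed_field_poly_normal h.
apply: sub_finite_set (finite_seq r) => z /= /rootP.
by rewrite hE rootZ ?lead_coef_eq0 // root_prod_XsubC.
Qed.

Lemma algebraic_set1 (w : plane R) : algebraic [set w].
Proof.
exists [set 'X_ord0 - w.1%:MP; 'X_ord_max - w.2%:MP].
apply/seteqP; split=> [_ -> r [] ->|z Hz].
- by rewrite mevalB mevalXU mevalC subrr.
- by rewrite mevalB mevalXU mevalC subrr.
have z1 : z.1 - w.1 = 0.
  by rewrite -(Hz _ (or_introl erefl)) mevalB mevalXU mevalC.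
have z2 : z.2 - w.2 = 0.
  by rewrite -(Hz _ (or_intror erefl)) mevalB mevalXU mevalC.
by case: z w z1 z2 {Hz} => [a b] [c e] /= /subr0_eq -> /subr0_eq ->.
Qed.

Lemma algebraicU (A B : set (plane R)) :
  algebraic A -> algebraic B -> algebraic (A `|` B).
Proof.
move=> [S ->] [T ->].
exists [set r | exists2 p, S p & exists2 q, T q & r = p * q].
apply/seteqP; split=> z.
  by case=> Hz _ [p Sp [q Tq ->]]; rewrite mevalM;
    [rewrite (Hz p Sp) mul0r|rewrite (Hz q Tq) mulr0].
move=> Hz; apply: contrapT => /not_orP[/existsNP[p /not_implyP[Sp p0]]].
move=> /existsNP[q /not_implyP[Tq q0]].
have : (p * q).@[pt z] = 0 by apply: Hz; exists p => //; exists q.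
by move=> /eqP; rewrite mevalM mulf_eq0 => /orP[] /eqP.
Qed.

Lemma algebraic_finite (A : set (plane R)) : finite_set A -> algebraic A.
Proof.
move=> /finite_seqP[s ->]; elim: s => [|w s IH].
  exists [set 1]; apply/seteqP; split=> [//|z /(_ 1 erefl)/eqP].
  by rewrite meval1 oner_eq0.
rewrite (_ : [set` _] = [set w] `|` [set` s]); last first.
  by apply/seteqP; split=> z /=; rewrite inE;
    [move=> /orP[/eqP|]; [left|right]|case=> [->|->]; rewrite ?eqxx ?orbT].
by apply: algebraicU => //; exact: algebraic_set1.
Qed.

Lemma irreducible_set1 (w : plane R) : irreducible [set w].
Proof.
split; [exact: algebraic_set1|by exists w|move=> A B _ _ AB].
have ABw z : A z \/ B z -> z = w.
  by move=> ABz; suff : [set w] z by []; rewrite AB.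
have : (A `|` B) w by rewrite -AB.
by case=> [Aw|Bw]; [left|right]; apply/seteqP; split=> [_ ->//|z Az];
  apply: ABw; [left|right].
Qed.

Lemma irreducible_finite (A : set (plane R)) :
  irreducible A -> finite_set A -> exists w, A = [set w].
Proof.
move=> [_ [w Aw] irrA] finA; exists w.
(* A finite set splits into the algebraic sets [[set w]] and its complement in [A]; the latter
   misses [w]. *)
have [|||//|AE] := irrA [set w] (A `\ w).
- exact: algebraic_set1.
- by apply: algebraic_finite; apply: sub_finite_set finA => z [].
- by rewrite setD1K.
by exfalso; move: Aw; rewrite AE => -[_ /(_ erefl)].
Qed.

(** * Curves parametrized by polynomials *)

Definition param_curve (p q : {poly C}) : set (plane R) :=
  range (fun z => (p.[z], q.[z])).

Lemma size_polyBC (A : nzRingType) (p : {poly A}) c :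
  (1 < size p)%N -> size (p - c%:P) = size p.
Proof.
move=> sp; rewrite size_polyDl // size_polyN (leq_ltn_trans _ sp) //.
by rewrite size_polyC leq_b1.
Qed.

Lemma poly_surj (p : {poly C}) c : (1 < size p)%N -> exists z, p.[z] = c.
Proof.
move=> sp; have [|z] := @closed_rootP C (p - c%:P) _.
  by rewrite size_polyBC //; case: size sp => [|[]].
by rewrite /root hornerD hornerN hornerC subr_eq0 => /eqP; exists z.
Qed.

(** Nonvanishing leading coefficients preserve the sizes, so the Sylvester matrix is mapped
    entrywise. *)
Lemma map_resultant_rmorph (A B : comNzRingType) (f : {rmorphism A -> B})
    (p q : {poly A}) :
    f (lead_coef p) != 0 -> f (lead_coef q) != 0 ->
  resultant (map_poly f p) (map_poly f q) = f (resultant p q).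
Proof.
move=> fp fq; rewrite /resultant /Sylvester_mx !size_map_poly_id0 //.
rewrite -det_map_mx map_col_mx; congr (\det (col_mx _ _)); apply/esym;
  by apply: map_lin1_mx => v; rewrite /= map_poly_rV rmorphM /= map_rVpoly.
Qed.

(** For nonconstant [p] the leading coefficient of p - X_i is a nonzero constant, so no
    specialization lowers the degree. *)
Lemma lift_polyBX (p : {poly C}) (i : 'I_2) : (1 < size p)%N ->
  exists P : {poly {mpoly C[2]}}, forall w,
    map_poly (meval (pt w)) P = p - (pt w i)%:P /\
    (lead_coef P).@[pt w] != 0.
Proof.
move=> sp; exists (map_poly (@mpolyC 2 C) p - ('X_i)%:P) => w; split.
  rewrite rmorphB /= map_polyC /= mevalXU -map_poly_comp.
  by rewrite (@eq_map_poly _ _ _ id) ?map_poly_id // => c /=; rewrite mevalC.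
have injC : injective (@mpolyC 2 C).
  by move=> a b /eqP; rewrite mpolyC_eq => /eqP.
have sl : size (map_poly (@mpolyC 2 C) p) = size p by exact: size_map_inj_poly.
rewrite lead_coefDl.
  by rewrite lead_coef_map_inj // mevalC lead_coef_eq0 -size_poly_gt0 ltnW.
rewrite size_polyN size_polyC sl; exact: leq_ltn_trans (leq_b1 _) sp.
Qed.

(** A point (a, b) lies on the curve iff p - a and q - b have a common root, that is, iff their
    resultant vanishes. *)
Lemma param_curve_algebraic (p q : {poly C}) :
  (1 < size p)%N -> (1 < size q)%N -> algebraic (param_curve p q).
Proof.
move=> sp sq; have [P PE] := lift_polyBX ord0 sp.
have [Q QE] := lift_polyBX ord_max sq.
exists [set resultant P Q].
have resE w : (resultant P Q).@[pt w] = 0 <->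
    (1 < size (gcdp (p - w.1%:P) (q - w.2%:P)))%N.
  have [Pw lP] := PE w; have [Qw lQ] := QE w.
  have <- := @map_resultant_rmorph _ _ (meval (pt w)) _ _ lP lQ.
  by rewrite Pw Qw -resultant_eq0; split=> /eqP.
have in_curve w : param_curve p q w <->
    exists z, root (gcdp (p - w.1%:P) (q - w.2%:P)) z.
  have rootE z : root (gcdp (p - w.1%:P) (q - w.2%:P)) z <->
      (p.[z], q.[z]) = w.
    rewrite root_gcd /root !hornerE !subr_eq0; case: w => a b.
    by split=> [/andP[/eqP -> /eqP ->]|[-> ->]]; rewrite ?eqxx.
  by split=> [[z _ /rootE ?]|[z /rootE <-]]; exists z.
apply/seteqP; split=> w.
  move=> /in_curve[z rz] _ ->; apply/resE.
  rewrite (root_size_gt1 _ rz) // gcdp_eq0 negb_and -size_poly_gt0.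
  by rewrite size_polyBC // ltnW.
move=> /(_ _ erefl)/resE s1; apply/in_curve/closed_rootP.
by case: size s1 => [|[]].
Qed.

Lemma pullback (p q : {poly C}) (r : {mpoly C[2]}) :
  exists h : {poly C}, forall z, h.[z] = r.@[pt (p.[z], q.[z])].
Proof.
pose K : set (C -> C) := [set f | exists h : {poly C}, forall z, h.[z] = f z].
apply: (mpoly_closed r (K := K)) => [c|a b [f fE] [g gE]|a b [f fE] [g gE]||].
- by exists c%:P => z; rewrite hornerC.
- by exists (f + g) => z; rewrite hornerD fE gE.
- by exists (f * g) => z; rewrite hornerM fE gE.
- by exists p.
- by exists q.
Qed.

(** An equation of [A] failing somewhere on the curve pulls back to a nonzero polynomial, whose
    finitely many roots parametrize all of [A]. *)
Lemma param_curve_sub (p q : {poly C}) (A : set (plane R)) :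
    algebraic A -> A `<=` param_curve p q -> A != param_curve p q ->
  finite_set A.
Proof.
move=> [S ->] sub /eqP neq.
have [z nz] : exists z, ~ zero_locus S (p.[z], q.[z]).
  apply: contrapT => /forallNP H; apply: neq.
  apply/seteqP; split=> // _ [z _ <-].
  by apply: contrapT; exact: H.
move: nz => /existsNP[r /not_implyP[Sr rz]].
have [h hE] := pullback p q r.
have h0 : h != 0 by apply: contra_notN rz => /eqP h0; rewrite -hE h0 horner0.
apply: sub_finite_set
  (finite_image (fun z => (p.[z], q.[z])) (finite_roots h0)).
move=> w Sw; have [y _ yw] := sub _ Sw; exists y => //=.
by rewrite hE yw; apply: Sw.
Qed.

Lemma param_curve_infinite (p q : {poly C}) :
  (1 < size p)%N -> infinite_set (param_curve p q).
Proof.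
move=> sp /(finite_image fst); rewrite (_ : _ @` _ = setT).
  exact: infinite_C.
apply/seteqP; split=> // c _; have [z zc] := poly_surj c sp.
by exists (p.[z], q.[z]) => //; exists z.
Qed.

(** Proper algebraic subsets are finite, whereas the curve is infinite; hence it is not a union of
    two of them. *)
Lemma param_curve_affine_curve (p q : {poly C}) :
  (1 < size p)%N -> (1 < size q)%N -> affine_curve (param_curve p q).
Proof.
move=> sp sq; have infA := @param_curve_infinite p q sp.
have algA := param_curve_algebraic sp sq.
have irrA : irreducible (param_curve p q).
  split=> //; first by exists (p.[0], q.[0]); exists 0.
  move=> A B algAA algB AB; apply: contrapT => /not_orP[nA nB].
  apply: infA; rewrite AB finite_setU; split.
    by apply: (@param_curve_sub p q) => //;
      [rewrite AB; left|apply/eqP => /esym].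
  by apply: (@param_curve_sub p q) => //;
      [rewrite AB; right|apply/eqP => /esym].
split=> //; split.
  pose w := (p.[0], q.[0]) : plane R.
  have Aw : param_curve p q w by exists 0.
  exists (fun k => if k == 0 then [set w] else param_curve p q); split.
    move=> [|[|//]] _ /=; split=> //; first exact: irreducible_set1.
    by move=> _ ->.
  move=> [|//] _ /=; split=> [_ ->//|sub].
  by apply: infA; apply: sub_finite_set sub _; exact: finite_set1.
(* In a chain of length at least 2, [Z 1] is finite and irreducible, hence a point, and cannot
   strictly contain the nonempty [Z 0]. *)
move=> m Z [HZ ltZ]; rewrite leqNgt; apply/negP => m1.
have [irrZ1 Z1A] := HZ 1%N (ltnW m1).
have [sub01 nsub10] := ltZ 0%N (ltnW m1).
have [sub12 nsub21] := ltZ 1%N m1.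
have [_ Z2A] := HZ 2%N m1.
have finZ1 : finite_set (Z 1%N).
  apply: param_curve_sub Z1A _; first by case: irrZ1.
  by apply/eqP => Z1E; apply: nsub21; rewrite Z1E.
have [w Z1w] := irreducible_finite irrZ1 finZ1.
have [[_ [y Z0y] _] _] := HZ 0%N isT.
apply: nsub10 => z; rewrite Z1w => ->.
by move: (Z0y) => /sub01; rewrite Z1w => <-.
Qed.
End PolynomialCurves.

(** * The family of invariant curves *)

Section InvariantFamily.
Variable R : realType.
Local Notation C := R[i].
Local Notation pt := (@coords R).

(* dickson n evaluates at s + 1/s to s^n + 1/s^n; it is locked because
   unification would otherwise unfold it on closed indices. *)
Fixpoint dickson2 n : {poly C} * {poly C} :=
  if n is n'.+1 then
    let: (a, b) := dickson2 n' in (b, 'X * b - a)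
  else (2%:P, 'X).

Definition dickson n := locked (dickson2 n).1.

Lemma dicksonSS n : dickson n.+2 = 'X * dickson n.+1 - dickson n.
Proof. by rewrite /dickson -!lock /=; case: (dickson2 n). Qed.

Lemma dicksonE s n : s != 0 ->
  (dickson n).[s + s^-1] = s ^+ n + (s ^+ n)^-1.
Proof.
move=> s0; suff [] : (dickson n).[s + s^-1] = s ^+ n + (s ^+ n)^-1 /\
  (dickson n.+1).[s + s^-1] = s ^+ n.+1 + (s ^+ n.+1)^-1 by [].
elim: n => [|n [e0 e1]].
  by rewrite /dickson -!lock /= hornerC hornerX expr0 expr1 invr1.
split=> //; rewrite dicksonSS hornerD hornerN hornerM hornerX e0 e1 !exprS.
by field; rewrite s0 expf_neq0.
Qed.

(** This form isolates s^n as an atom for [field]; exponents below are therefore written as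
    [1 * n + 4] or [0 * n + 3]. *)
Lemma dicksonE2 s n k l : s != 0 ->
  (dickson (k * n + l)).[s + s^-1] =
    (s ^+ n) ^+ k * s ^+ l + ((s ^+ n) ^+ k * s ^+ l)^-1.
Proof. by move=> s0; rewrite dicksonE // exprD mulnC exprM. Qed.

Lemma coef_dickson n j : (n < j)%N -> (dickson n)`_j = 0.
Proof.
move: n j; suff H n : (forall j, (n < j)%N -> (dickson n)`_j = 0) /\
    (forall j, (n.+1 < j)%N -> (dickson n.+1)`_j = 0).
  by move=> n j; case: (H n) => /(_ j).
elim: n => [|n [e0 e1]] /=.
  by split=> -[|[|k]] // _; rewrite /dickson -!lock /= ?coefC ?coefX.
split=> // -[//|k] kn; rewrite dicksonSS coefB coefXM /= e1 // e0 ?subr0 //.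
by rewrite (ltn_trans _ kn) // -addn2 leq_addr.
Qed.

Lemma lead_dickson n : (dickson n.+1)`_n.+1 = 1.
Proof.
elim: n => [|n IH]; first by rewrite /dickson -!lock /= coefX.
by rewrite dicksonSS coefB coefXM /= IH coef_dickson ?subr0.
Qed.

(* With t = (s, s^(n+2), s^-(n+3)), u = e_1(t) and v = e_2(t), these are uv and
   (u^3 + v^3) / 2 as polynomials in s + 1/s. *)
Definition Pn n : {poly C} :=
  dickson (2 * n + 5) + dickson (1 * n + 4) + dickson (1 * n + 1) + 3%:P.

Definition Qn n : {poly C} :=
  2^-1 *: (dickson (3 * n + 9) + dickson (3 * n + 6) + dickson (0 * n + 3))
  + 3 *: (dickson (2 * n + 5) + dickson (1 * n + 4) + dickson (1 * n + 1))
  + 6%:P.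

Lemma coef_size_gt1 (p : {poly C}) j : (0 < j)%N -> p`_j != 0 -> (1 < size p)%N.
Proof.
move=> j0; apply: contraR; rewrite -leqNgt => sp.
by rewrite nth_default // (leq_trans sp).
Qed.

Lemma Pn_size n : (1 < size (Pn n))%N.
Proof.
apply: (@coef_size_gt1 _ (2 * n + 5)); first by rewrite addnS.
rewrite !coefD coefC [(2 * n + 5)%N]addnS lead_dickson /=.
by rewrite !coef_dickson ?addr0 ?oner_neq0 //; lia.
Qed.

Lemma Qn_size n : (1 < size (Qn n))%N.
Proof.
apply: (@coef_size_gt1 _ (3 * n + 9)); first by rewrite addnS.
rewrite !(coefD, coefZ) coefC [(3 * n + 9)%N]addnS lead_dickson.
rewrite !coef_dickson; try lia.
by rewrite !(addr0, mulr0) mulr1 invr_eq0 two_neq0.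
Qed.

Definition par n (s : C) : plane R :=
  inv12 (e12 (tri s (s ^+ n.+2) (s ^+ n.+3)^-1)).

(** Since the torus entries have product 1, uv is the sum of all their pairwise quotients: three
    equal 1, the others are powers of s with exponents n + 1, n + 4, 2n + 5 up to sign. *)
Lemma parE n s : s != 0 -> par n s = ((Pn n).[s + s^-1], (Qn n).[s + s^-1]).
Proof.
move=> s0; rewrite /par e12_tri /inv12 /= /Pn /Qn !(hornerD, hornerZ, hornerC).
rewrite !dicksonE2 // !(exprS, expr0, mul1r, mulr1).
have := expf_neq0 n s0; move: (s ^+ n) => a a0; have two0 := two_neq0 R.
by congr pair; field; rewrite ?s0 ?a0 ?two0.
Qed.

Definition curve n := param_curve (Pn n) (Qn n).

Lemma curveE n : curve n = par n @` [set s | s != 0].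
Proof.
apply/seteqP; split=> _ [z z0 <-]; last by exists (z + z^-1); rewrite ?parE.
(* Every z is s + 1/s for a root s of X^2 - z X + 1. *)
have [s s2] := quadratic_root (-1) z.
have s0 : s != 0.
  apply: contra_eqN s2 => /eqP ->.
  by rewrite expr0n mulr0 addr0 eq_sym oppr_eq0 oner_neq0.
exists s => //; rewrite parE //.
suff -> : s + s^-1 = z by [].
by apply: (mulfI s0); rewrite mulrDr mulfV // -expr2 s2 mulrC; ring.
Qed.

Lemma par_torus n (s : C) : s != 0 -> torus (tri s (s ^+ n.+2) (s ^+ n.+3)^-1).
Proof. by move=> s0; apply: torus_tri; rewrite -exprS mulfV // expf_neq0. Qed.

Lemma g_par n d s : s != 0 -> pmap_eval (g_cheb R d) (par n s) = par n (s ^+ d).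
Proof.
move=> s0; rewrite /par g_cheb_e12; last exact: par_torus.
rewrite e12_tri; congr inv12; apply: e12E => //=.
  by rewrite -!exprM mulnC.
by rewrite exprVn -!exprM mulnC.
Qed.

Lemma curve_invariant n d : (0 < d)%N ->
  pmap_eval (g_cheb R d) @` curve n = curve n.
Proof.
move=> d0; rewrite curveE; apply/seteqP; split.
  move=> _ [_ [s s0 <-] <-].
  by exists (s ^+ d); [exact: expf_neq0|rewrite g_par].
move=> _ [s s0 <-];
(* A d-th root [r] of [s] gives the preimage. *)
have [|r] := @closed_rootP C ('X^d - s%:P) _.
  by rewrite size_XnsubC // eqSS -lt0n.
rewrite /root !hornerE subr_eq0 => /eqP rd.
have r0 : r != 0 by apply: contraNneq s0 => r0; rewrite -rd r0 expr0n gtn_eqF.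
by exists (par n r); [exists r|rewrite g_par // rd].
Qed.

(** * Infinitude of the family by a density argument *)

Definition surf (s t : C) : plane R := inv12 (e12 (tri s t (s * t)^-1)).

Lemma surfC s t : surf s t = surf t s.
Proof. by rewrite /surf !e12_tri [t * s]mulrC; congr (inv12 (_, _)); ring. Qed.

Lemma surf_par n s : surf s (s ^+ n.+2) = par n s.
Proof. by rewrite /surf -exprS. Qed.

Lemma surf_surj w : exists s t, [/\ s != 0, t != 0 & surf s t = inv12 w].
Proof.
have [f tf <-] := e12_surj w; have [x [y [z [xyz fx fy fz]]]] := torusE tf.
have xy0 : x * y != 0.
  by apply: contra_eqN xyz => /eqP ->; rewrite mul0r eq_sym oner_neq0.
have [x0 y0] : x != 0 /\ y != 0 by apply/andP; rewrite -negb_or -mulf_eq0.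
exists x, y; split=> //; rewrite /surf e12_tri (e12E fx fy fz).
by have -> : z = (x * y)^-1 by apply: (mulfI xy0); rewrite xyz mulfV.
Qed.

(** For fixed [s] the pullback of [p] is a Laurent polynomial in t; times a power of t it is a
    polynomial with infinitely many roots. *)
Lemma surf_vanish (p : {mpoly C[2]}) s : s != 0 ->
    infinite_set [set t | t != 0 /\ p.@[pt (surf s t)] = 0] ->
  forall t, t != 0 -> p.@[pt (surf s t)] = 0.
Proof.
move=> s0; pose K : set (C -> C) := [set f | exists (k : nat) (h : {poly C}),
  forall t, t != 0 -> t ^+ k * f t = h.[t]].
have Kc c : K (fun=> c) by exists 0%N, c%:P => t _; rewrite mul1r hornerC.
have KD a b : K a -> K b -> K (fun x => a x + b x).
  move=> [k [f fE]] [l [g gE]]; exists (k + l)%N, ('X^l * f + 'X^k * g) => t t0.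
  by rewrite hornerD !hornerM !hornerXn -fE // -gE // exprD; ring.
have KM a b : K a -> K b -> K (fun x => a x * b x).
  move=> [k [f fE]] [l [g gE]]; exists (k + l)%N, (f * g) => t t0.
  by rewrite hornerM -fE // -gE // exprD; ring.
have Kt : K id by exists 0%N, 'X => t _; rewrite mul1r hornerX.
have KV : K (fun t => t^-1).
  by exists 1%N, 1 => t t0; rewrite expr1 mulfV // hornerC.
(* These are e_1 and e_2 of (s, t, 1/(st)). *)
pose u t := s + t + s^-1 * t^-1; pose v t := s * t + t^-1 + s^-1.
have Ku : K u := KD _ _ (KD _ _ (Kc s) Kt) (KM _ _ (Kc s^-1) KV).
have Kv : K v := KD _ _ (KD _ _ (KM _ _ (Kc s) Kt) KV) (Kc s^-1).
have Kcube a : K a -> K (fun x => a x ^+ 3).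
  by move=> Ka; apply: (KM _ _ Ka (KM _ _ Ka Ka)).
have [k [h hE]] :
    K (fun t => p.@[pt (u t * v t, (u t ^+ 3 + v t ^+ 3) * 2^-1)]).
  apply: mpoly_closed => //; first exact: (KM _ _ Ku Kv).
  exact: (KM _ _ (KD _ _ (Kcube _ Ku) (Kcube _ Kv)) (Kc 2^-1)).
have surfE t : t != 0 -> surf s t = (u t * v t, (u t ^+ 3 + v t ^+ 3) * 2^-1).
  move=> t0; rewrite /surf e12_tri -[RHS]/(inv12 (u t, v t)) /u /v.
  by congr (inv12 (_, _)); field; rewrite s0 t0.
move=> inf t t0.
have h0 : h = 0.
  apply/eqP; apply: contra_notT inf => h0.
  apply: sub_finite_set (finite_roots h0) => r [r0 pr] /=.
  by rewrite -hE // -surfE // pr mulr0.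
by apply: (mulfI (expf_neq0 k t0)); rewrite mulr0 surfE // hE // h0 horner0.
Qed.

Lemma infinite_curves : infinite_set (range curve).
Proof.
move=> finF.
(* Pigeonhole: some [A] equals [curve n] for infinitely many n. *)
have [A [n0 _ n0A] infN] :
    exists2 A, range curve A & infinite_set [set n | curve n = A].
  apply: contrapT => /forall2NP H; apply: infinite_nat.
  rewrite (_ : setT = \bigcup_(A in range curve) [set n | curve n = A]).
    by apply: bigcup_finite => // A FA; have [] := H A => // /contrapT.
  by apply/seteqP; split=> // n _; exists (curve n) => //; exists n.
have algA : algebraic A.
  rewrite -n0A.
  by apply: param_curve_algebraic; [exact: Pn_size|exact: Qn_size].
have inA w : A (inv12 w).
  have [S AS] := algA; rewrite AS => p Sp.
  have [s [t [s0 t0 <-]]] := surf_surj w.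
  have van n s' : s' != 0 -> curve n = A -> p.@[pt (surf s' (s' ^+ n.+2))] = 0.
    move=> s'0 nA; have : A (par n s') by rewrite -nA curveE; exists s'.
    by rewrite AS surf_par; exact.
  have nat0 k : k.+2%:R != 0 :> C by rewrite Num.Theory.pnatr_eq0.
  (* The base k + 2 exceeds 1, so its powers are pairwise distinct and supply infinitely many zeros
     in t. *)
  have van2 k t' : t' != 0 -> p.@[pt (surf k.+2%:R t')] = 0.
    apply: surf_vanish => // fin; apply: infN.
    apply: sub_finite_set
      (finite_preimage (f := fun n => k.+2%:R ^+ n.+2) _ fin).
      by move=> n nA /=; split; [exact: expf_neq0|exact: van].
    move=> m n _ _ /eqP; rewrite -!natrX Num.Theory.eqr_nat eqn_exp2l //.
    by move=> /eqP[].
  (* Now t is fixed, and the zeros s = k + 2 settle the other variable. *)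
  rewrite surfC; apply: surf_vanish s0 => // fin; apply: infinite_nat.
  apply: sub_finite_set (finite_preimage (f := fun k => k.+2%:R) _ fin).
    by move=> k _ /=; split=> //; rewrite surfC; exact: van2.
  by move=> m n _ _ /eqP; rewrite Num.Theory.eqr_nat => /eqP[].
have P0 : Pn n0 != 0 by rewrite -size_poly_gt0 ltnW // Pn_size.
(* Each (0, y) is the image of (0, v) with v^3 = 2y, so every y would be a value of [Qn n0] at a
   root of [Pn n0]. *)
apply: (@infinite_C R); apply: sub_finite_set
  (finite_image (fun z => (Qn n0).[z]) (finite_roots P0)) => y _.
have [v v3] := cubic_root (2 * y) 0 0.
have := inA (0, v); rewrite -n0A => -[z _ []] /=.
rewrite mul0r => Pz Qz; exists z => //; rewrite Qz v3 expr0n /= add0r !mul0r.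
by rewrite !addr0 mulrC mulKf // two_neq0.
Qed.

End InvariantFamily.

Theorem proposition3p17 (R : realType) :
  infinite_set [set A : set (plane R) |
    affine_curve A /\
    forall d : nat, (0 < d)%N -> pmap_eval (g_cheb R d) @` A = A].
Proof.
apply: sub_infinite_set (@infinite_curves R) => _ [n _ <-]; split.
  by apply: param_curve_affine_curve; [exact: Pn_size|exact: Qn_size].
by move=> d; exact: curve_invariant.
Qed.
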